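(* Let $a>0$ and $0<\rho\le 1$, and let $\mathcal{K}_{\rho,a}:L^2[-a,a]\to L^2[-a,a]$ be the integral operator $$\mathcal{K}_{\rho,a}f(x)=C_\rho\int_{-a}^{a}|x-y|^{\rho}f(y)\,dy,\qquad C_\rho=\frac{-1}{2\,\Gamma(1+\rho)\,\sin\frac{\pi\rho}{2}}.$$ Then the eigenvalue problem $\mathcal{K}_{\rho,a}f=\mu f$, $f\in L^2[-a,a]$, $f\neq 0$, admits at least one negative eigenvalue $\mu<0$.
   Context: $L^2[-a,a]$ is the space of (real-valued) square integrable functions on $[-a,a]$. The constant $C_\rho$ is negative for $0<\rho\le 1$, with $C_1=-1/2$; for $0<\rho<1$ it equals $\Gamma(-\rho)/\bigl(\Gamma(\tfrac{1-\rho}{2})\Gamma(\tfrac{1+\rho}{2})\bigr)$. The operator $\mathcal{K}_{\rho,a}$ is compact and self-adjoint. *)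

(* Defs.v *)
From HB Require Import structures.
From mathcomp Require Import all_boot all_order all_algebra.
From mathcomp Require Import all_classical all_reals all_analysis.
From mathcomp Require Import measurable_realfun.
From mathcomp Require Import ring lra.
Set Implicit Arguments.
Unset Strict Implicit.
Unset Printing Implicit Defensive.
Import Order.TTheory GRing.Theory Num.Theory.
Import numFieldNormedType.Exports.
Local Open Scope classical_set_scope.
Local Open Scope ring_scope.

(* Euler's integral: the value is junk (0) outside 0 < s, where it diverges. *)
Definition Gamma (R : realType) (s : R) : R :=
  \int[lebesgue_measure]_(t in `]0, +oo[) (t `^ (s - 1) * expR (- t)).

Definition Criesz (R : realType) (rho : R) : R :=
  - 1 / (2 * Gamma (1 + rho) * sin (pi * rho / 2)).

(* Lebesgue measure on [-a, a], viewed as a measure on the whole line. *)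
Definition leb (R : realType) (a : R) :
    {measure set (measurableTypeR R) -> \bar R} :=
  mrestr (@lebesgue_measure R) (measurable_itv `[- a, a]).

Definition L2 (R : realType) (a : R) := LfunType (leb a) (lee1n 2).

Definition riesz_fun (R : realType) (rho a : R) (f : R -> R) (x : R) : R :=
  Criesz rho *
  \int[lebesgue_measure]_(y in `[- a, a]) (`|x - y| `^ rho * f y).

Section L2_stability.
Variables (R : realType) (rho a : R).
Hypothesis rho0 : 0 < rho.
Let lbm := @lebesgue_measure R.
Let D : set (measurableTypeR R) := `[- a, a].
Let mD : measurable D. Proof. exact: measurable_itv. Qed.

Lemma measurable_riesz_fun (f : R -> R) :
  measurable_fun setT f -> measurable_fun setT (riesz_fun rho a f).
Proof.
move=> mf; apply: measurable_funM => //.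
rewrite /Rintegral; apply: measurableT_comp => //.
pose h (z : measurableTypeR R * measurableTypeR R) : \bar R :=
  ((`|z.1 - z.2| `^ rho * f z.2) * \1_D z.2)%:E.
have mh : measurable_fun setT h.
  apply/measurable_EFinP/measurable_funM.
    apply: measurable_funM; last exact: measurableT_comp mf measurable_snd.
    apply: (measurableT_comp (@measurable_powR R rho)).
    apply: (measurableT_comp (@normr_measurable R setT)).
    by apply: measurable_funB; [exact: measurable_fst|exact: measurable_snd].
  by apply: (measurableT_comp _ measurable_snd); exact: measurable_indic.
rewrite [X in measurable_fun _ X](_ : _ = fun x =>
    (\int[lbm]_y (h^\+)%E (x, y) - \int[lbm]_y (h^\-)%E (x, y))%E).
  apply: emeasurable_funB.
    by apply: measurable_fun_fubini_tonelli_F => //; exact: measurable_funepos.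
  by apply: measurable_fun_fubini_tonelli_F => //; exact: measurable_funeneg.
apply/funext => x; rewrite integral_mkcond integralE.
have hE : (fun y => h (x, y)) = (fun y => (`|x - y| `^ rho * f y)%:E) \_ D.
  apply/funext => y; rewrite /h patchE /= indicE.
  by case: (y \in D); rewrite ?mulr1 ?mulr0.
by rewrite -hE; congr (_ - _)%E; apply: eq_integral => y _;
  rewrite ?funeposE ?funenegE.
Qed.

Lemma L2_integrable (f : L2 a) : lbm.-integrable D (EFin \o f).
Proof.
have mf : measurable_fun setT (EFin \o f) by exact/measurable_EFinP.
have fin : leb a setT \is a fin_num.
  rewrite ge0_fin_numE//= /mrestr setTI.
  by rewrite lebesgue_measure_itv/=; case: ifP => _; rewrite ltry.
have /Lfun1_integrable : (f : R -> R) \in Lfun (leb a) 1.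
  by apply: (Lfun_subset _ _ fin _ (LfunP f)) => //; rewrite lee1n.
move=> /(integrableS measurableT mD (@subsetT _ D)) /integrableP[_ foo].
apply/integrableP; split; first exact: measurable_funTS.
rewrite (_ : integral _ _ _ = \int[leb a]_(x in D) `|(EFin \o f) x|)%E//.
apply: eq_measure_integral => A mA AD.
by rewrite /= /mrestr setIidl.
Qed.

Lemma L2_riesz_fun (f : L2 a) : riesz_fun rho a f \in Lfun (leb a) 2%:E.
Proof.
have mf : measurable_fun setT f by [].
have mK := measurable_riesz_fun mf.
rewrite inE; apply/andP; split; rewrite inE//=.
have intf := L2_integrable f.
have intnf : lbm.-integrable D (fun y => `|f y|%:E).
  exact: (integrable_norm intf).
pose M := `|Criesz rho| * ((2 * `|a|) `^ rho * \int[lbm]_(y in D) `|f y|).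
have M0 : 0 <= M.
  by rewrite !mulr_ge0 ?powR_ge0//; apply: Rintegral_ge0.
have KM x : D x -> `|riesz_fun rho a f x| <= M.
  rewrite /D/= in_itv/= => /andP[ax xa].
  have bd y : D y -> `|x - y| `^ rho <= (2 * `|a|) `^ rho.
    rewrite /D/= in_itv/= => /andP[ay ya].
    apply: ge0_ler_powR; rewrite ?nnegrE ?mulr_ge0 ?(ltW rho0)//.
    have := ler_norm a; rewrite ler_norml => aa; apply/andP; split; lra.
  rewrite /riesz_fun normrM ler_wpM2l//.
  have ig : lbm.-integrable D (fun y => ((2 * `|a|) `^ rho * `|f y|)%:E).
    exact: (@integrableZl _ _ _ lbm D mD _ _ intnf).
  have mk : measurable_fun D (fun y : R => `|x - y| `^ rho * f y).
    apply: measurable_funTS; apply: measurable_funM => //.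
    apply: (measurableT_comp (@measurable_powR R rho)).
    apply: (measurableT_comp (@normr_measurable R setT)).
    by apply: measurable_funB.
  have ik : lbm.-integrable D (fun y => (`|x - y| `^ rho * f y)%:E).
    apply: le_integrable ig => //; first exact/measurable_EFinP.
    move=> y Dy; rewrite /= lee_fin !normrM normr_id !(ger0_norm (powR_ge0 _ _)).
    by rewrite ler_wpM2r// bd.
  apply: (le_trans (le_normr_Rintegral _ _)) => //.
  rewrite -RintegralZl//; apply: le_Rintegral => //.
    exact: (integrable_norm ik).
  move=> y Dy; rewrite normrM (ger0_norm (powR_ge0 _ _)).
  by rewrite ler_wpM2r// bd.
have mleb : leb a (~` D) = 0%E by rewrite /= /mrestr setICl measure0.
rewrite /finite_norm unlock /Lnorm poweR_lty//.
have Moo : (\int[leb a]_x (M `^ 2)%:E < +oo)%E.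
  rewrite integral_cst//= lte_mul_pinfty ?lee_fin ?powR_ge0//.
  rewrite /mrestr setTI.
  by rewrite lebesgue_measure_itv/=; case: ifP => _; rewrite ltry.
apply: le_lt_trans Moo.
rewrite (_ : integral _ _ _ =
    \int[leb a]_x (`|riesz_fun rho a f x| `^ 2)%:E)%E//.
apply: ae_ge0_le_integral => //.
- apply/measurable_EFinP.
  apply: (measurableT_comp (@measurable_powR R 2)).
  exact: measurableT_comp.
- by move=> x _; rewrite lee_fin powR_ge0.
- exists (~` D); split => //; first exact: measurableC.
  move=> x/= /not_implyP[_ nK] Dx; apply: nK.
  by rewrite lee_fin ge0_ler_powR ?nnegrE ?KM.
Qed.

Definition riesz_op (f : L2 a) : L2 a := Lfun_Sub (lee1n 2) (L2_riesz_fun f).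

Lemma riesz_opE (f : L2 a) (x : R) :
  riesz_op f x = Criesz rho *
    \int[lebesgue_measure]_(y in `[- a, a]) (`|x - y| `^ rho * f y).
Proof. by []. Qed.

Lemma riesz_op_ae (f g : L2 a) : f = g %[ae leb a] -> riesz_op f =1 riesz_op g.
Proof.
move=> [N [mN N0 fgN]] x; congr (_ * fine _).
have mk (h : L2 a) : measurable_fun D (fun y => (`|x - y| `^ rho * h y)%:E).
  apply/measurable_EFinP/measurable_funTS; apply: measurable_funM => //.
  apply: (measurableT_comp (@measurable_powR R rho)).
  apply: (measurableT_comp (@normr_measurable R setT)).
  by apply: measurable_funB.
apply: ae_eq_integral => //.
exists (N `&` D); split => //; first exact: measurableI.
move=> y /= /not_implyP[Dy nK]; split => //; apply: fgN => /= H.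
by apply: nK; rewrite H.
Qed.

End L2_stability.

(* Elements of L2 a are functions rather than classes, so equality in L^2 is
   equality almost everywhere on [-a, a]; riesz_op_ae shows that riesz_op is
   compatible with it. *)
Definition eigenvalue_L2 (R : realType) (a : R) (K : L2 a -> L2 a) (mu : R) :=
  exists f : L2 a, ~ (f = 0 %[ae leb a]) /\ K f = mu *: f %[ae leb a].

(* Main.v *)
Require Import Defs.
From mathcomp Require Import all_boot all_order all_algebra.
From mathcomp Require Import all_classical all_reals all_analysis.
From mathcomp Require Import measurable_realfun.
From mathcomp Require Import ring lra.
Set Implicit Arguments.
Unset Strict Implicit.
Unset Printing Implicit Defensive.
Import Order.TTheory GRing.Theory Num.Theory.
Import numFieldNormedType.Exports.
Local Open Scope classical_set_scope.
Local Open Scope ring_scope.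

(** The constant [Criesz rho] is negative, so the task is to find a positive
eigenvalue of the operator with the nonnegative kernel |x - y|^rho; this is a
Perron-Frobenius (Jentzsch) statement, proved by a contraction argument.

Let T be a positive integral operator with bounded kernel k on a finite
measure space. If the kernel of S = T o T is at least m > 0 everywhere, then S
satisfies m * E h <= S h <= M * E h for every bounded h >= 0, where E is the
integral. Such an S contracts ratios: if al * f <= S f <= be * f, then
al' * S f <= S (S f) <= be' * S f with be' - al' = (1 - m / M) * (be - al),
because S maps each of the nonnegative functions S f - al * f and be * f - S f
to a function that is at least m times its integral ([gap_contracts]).
Iterating S from a constant and normalising by E = 1 gives a sequence that
converges uniformly at a geometric rate to a positive g with S g = nu * g
([exists_positive_eigenfunction]). Finally T g + sqrt nu * g is a positive
eigenfunction of T itself, for the eigenvalue sqrt nu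
([exists_positive_kernel_eigenfunction]).

The kernel |x - y|^rho vanishes on the diagonal, which is why T must be
squared: of all z in [-a, a], those within a / 4 of x or of y have measure at
most a, so the integral of |x - z|^rho |z - y|^rho over z is at least
a * (a / 4)^(2 rho) ([riesz_kernel2_ge]). The sign of the constant comes from
the integrability of t^rho exp (- t), which makes the Gamma factor a genuine
positive number ([Gamma_1D_gt0]). *)

(** * Sequences converging at a geometric rate *)

Section geometric_sequences.
Context {R : realType}.

Lemma geometric_le0 (r C x : R) : 0 <= r < 1 ->
  (forall n, x <= C * r ^+ n) -> x <= 0.
Proof.
move=> /andP[r0 r1] xr.
have cv : C * r ^+ n @[n --> \oo] --> C * 0.
  by apply: cvgMl_tmp; apply: cvg_expr; rewrite ger0_norm.
rewrite mulr0 in cv; rewrite -(cvg_lim _ cv)//.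
apply: limr_ge; first by apply/cvg_ex; exists 0.
exact: nearW.
Qed.

(** Adding or subtracting the tail A / (1 - r) * r ^+ n of the geometric series
turns u into a nonincreasing, respectively nondecreasing, sequence; the limit
is the supremum of the latter. *)
Lemma geometric_cauchy_limit (u : nat -> R) (r A : R) : 0 <= r < 1 ->
  (forall n, `|u n.+1 - u n| <= A * r ^+ n) ->
  exists l, forall n, `|u n - l| <= A / (1 - r) * r ^+ n.
Proof.
move=> /andP[r0 r1] uA; set B := A / (1 - r).
have BE n : B * r ^+ n - B * r ^+ n.+1 = A * r ^+ n.
  by rewrite exprS /B; field; lra.
have ndv : nondecreasing_seq (fun n => u n - B * r ^+ n).
  apply/nondecreasing_seqP => n.
  by have := uA n; rewrite ler_norml => /andP[]; have := BE n; lra.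
have niw : nonincreasing_seq (fun n => u n + B * r ^+ n).
  apply/nonincreasing_seqP => n.
  by have := uA n; rewrite ler_norml => /andP[]; have := BE n; lra.
have Bge0 n : 0 <= B * r ^+ n.
  rewrite mulr_ge0 ?exprn_ge0// divr_ge0//; last lra.
  by have := le_trans (normr_ge0 _) (uA 0%N); rewrite expr0 mulr1.
have vw n m : u n - B * r ^+ n <= u m + B * r ^+ m.
  apply: (le_trans (ndv _ _ (leq_maxl n m))).
  apply: le_trans (niw _ _ (leq_maxr n m)).
  by have := Bge0 (maxn n m); lra.
exists (sup (range (fun n => u n - B * r ^+ n))) => n.
rewrite distrC ler_distl; apply/andP; split.
  apply: ub_le_sup; last by exists n.
  by exists (u 0%N + B * r ^+ 0) => _ [k _ <-].
apply: ge_sup; first by exists (u 0%N - B * r ^+ 0), 0%N.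
by move=> _ [k _ <-].
Qed.
End geometric_sequences.

(** * Bounded measurable functions *)

Section bounded_measurable.
Context d (T : measurableType d) (R : realType).
Implicit Types f g : T -> R.

(** The bound holds at every point, not only almost everywhere: the eigenvalue
equation is solved pointwise, and L^2 only enters at the very end. *)
Definition bounded_mfun f :=
  measurable_fun setT f /\ exists B, forall x, `|f x| <= B.

Lemma bounded_mfun_cst c : bounded_mfun (fun=> c).
Proof. by split; [exact: measurable_cst | exists `|c|]. Qed.

Lemma bounded_mfunD f g : bounded_mfun f -> bounded_mfun g ->
  bounded_mfun (fun x => f x + g x).
Proof.
move=> [mf [B fB]] [mg [C gC]]; split; first exact: measurable_funD.
by exists (B + C) => x; rewrite (le_trans (ler_normD _ _))// lerD.
Qed.

Lemma bounded_mfunM f g : bounded_mfun f -> bounded_mfun g ->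
  bounded_mfun (fun x => f x * g x).
Proof.
move=> [mf [B fB]] [mg [C gC]]; split; first exact: measurable_funM.
by exists (B * C) => x; rewrite normrM ler_pM.
Qed.

Lemma bounded_mfunZ c f : bounded_mfun f -> bounded_mfun (fun x => c * f x).
Proof. exact/bounded_mfunM/bounded_mfun_cst. Qed.

Lemma bounded_mfunB f g : bounded_mfun f -> bounded_mfun g ->
  bounded_mfun (fun x => f x - g x).
Proof.
move=> bf bg; have := bounded_mfunD bf (bounded_mfunZ (-1) bg).
by under eq_fun do rewrite mulN1r.
Qed.

Lemma bounded_mfun_norm f : bounded_mfun f -> bounded_mfun (fun x => `|f x|).
Proof.
move=> [mf [B fB]]; split; last by exists B => x; rewrite normr_id.
exact: measurableT_comp.
Qed.

Lemma bounded_mfun_limit (f_ : nat -> T -> R) f (r C : R) : 0 <= r < 1 ->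
  (forall n, bounded_mfun (f_ n)) ->
  (forall n x, `|f_ n x - f x| <= C * r ^+ n) -> bounded_mfun f.
Proof.
move=> r01 bf fr; split.
  apply: (@measurable_fun_cvg _ _ _ _ f_); first by move=> n; case: (bf n).
  move=> x _.
  apply/cvgrPdist_le => e e0.
  have cv : C * r ^+ n @[n --> \oo] --> C * 0.
    by apply: cvgMl_tmp; apply: cvg_expr; rewrite ger0_norm; case/andP: r01.
  rewrite mulr0 in cv; move/cvgrPdist_le : cv => /(_ e e0) [N _ NP].
  exists N => // n Nn; rewrite distrC (le_trans (fr n x))//.
  by have := NP n Nn; rewrite sub0r normrN; apply: le_trans; exact: ler_norm.
have [_ [B fB]] := bf 0%N; exists (C + B) => x.
have := fr 0%N x; rewrite expr0 mulr1 distrC.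
have := fB x; have := ler_normD (f x - f_ 0%N x) (f_ 0%N x).
by rewrite subrK; lra.
Qed.

Variable mu : {finite_measure set T -> \bar R}.

Lemma bounded_mfun_integrable f : bounded_mfun f ->
  mu.-integrable setT (EFin \o f).
Proof.
move=> [mf [B fB]]; apply: measurable_bounded_integrable => //.
  by rewrite -ge0_fin_numE// fin_num_measure.
exists B; split; first exact: num_real.
by move=> x Bx t _; exact: le_trans (fB t) (ltW Bx).
Qed.

Lemma ler_Rintegral f g : bounded_mfun f -> bounded_mfun g ->
  (forall x, f x <= g x) -> \int[mu]_x f x <= \int[mu]_x g x.
Proof.
by move=> bf bg fg; apply: le_Rintegral => //; exact: bounded_mfun_integrable.
Qed.

Lemma Rintegral_linear a b f g : bounded_mfun f -> bounded_mfun g ->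
  \int[mu]_x (a * f x + b * g x) = a * \int[mu]_x f x + b * \int[mu]_x g x.
Proof.
move=> bf bg; rewrite RintegralD ?RintegralZl//;
  by [exact: bounded_mfun_integrable|
      apply: bounded_mfun_integrable; exact: bounded_mfunZ].
Qed.

End bounded_measurable.

Lemma bounded_mfun_comp d d' (T : measurableType d) (T' : measurableType d')
    (R : realType) (g : T' -> T) (f : T -> R) :
  measurable_fun setT g -> bounded_mfun f -> bounded_mfun (f \o g).
Proof.
move=> mg [mf [B fB]]; split; first exact: measurableT_comp.
by exists B => x; exact: fB.
Qed.

(** * Positive eigenfunctions of uniformly positive operators *)

Section positive_eigenfunction.
Context d (T : measurableType d) (R : realType).
Variable mu : {finite_measure set T -> \bar R}.
Variables (S : (T -> R) -> T -> R) (m M : R).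
Hypothesis mu_gt0 : 0 < fine (mu setT).
Hypothesis m_gt0 : 0 < m.
Hypothesis S_bounded : forall f, bounded_mfun f -> bounded_mfun (S f).
Hypothesis S_linear : forall a b f g, bounded_mfun f -> bounded_mfun g ->
  S (fun x => a * f x + b * g x) =1 fun x => a * S f x + b * S g x.
Hypothesis S_ge : forall f, bounded_mfun f -> (forall x, 0 <= f x) ->
  forall x, m * \int[mu]_y f y <= S f x.
Hypothesis S_le : forall f, bounded_mfun f -> (forall x, 0 <= f x) ->
  forall x, S f x <= M * \int[mu]_y f y.

Let V := fine (mu setT).
Let E (f : T -> R) := \int[mu]_x f x.

Let E_cst c : E (fun=> c) = c * V.
Proof. by rewrite /E Rintegral_cst. Qed.

Let m_le_M : m <= M.
Proof.
have b1 := @bounded_mfun_cst _ T R 1.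
have := le_trans (S_ge b1 (fun=> ler01) point) (S_le b1 (fun=> ler01) point).
by rewrite -/(E (fun=> 1)) E_cst mul1r ler_pM2r.
Qed.

Let M_gt0 : 0 < M. Proof. exact: lt_le_trans m_le_M. Qed.

Let S_comb f g a : bounded_mfun f -> bounded_mfun g ->
  forall x, S (fun y => f y - a * g y) x = S f x - a * S g x.
Proof.
move=> bf bg x; have /(_ x) := S_linear 1 (- a) bf bg.
rewrite mul1r mulNr => <-; congr (S _ x).
by apply/funext => y; rewrite mul1r mulNr.
Qed.

Let S_scale f a : bounded_mfun f ->
  forall x, S (fun y => a * f y) x = a * S f x.
Proof.
move=> bf x; have /(_ x) := S_linear a 0 bf bf.
rewrite mul0r addr0 => <-; congr (S _ x).
by apply/funext => y; rewrite mul0r addr0.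
Qed.

Let E_comb f g a : bounded_mfun f -> bounded_mfun g ->
  E (fun y => f y - a * g y) = E f - a * E g.
Proof.
move=> bf bg; have := Rintegral_linear mu 1 (- a) bf bg.
rewrite mul1r mulNr => <-; congr (Rintegral _ _ _).
by apply/funext => y; rewrite mul1r mulNr.
Qed.

Let E_scale f a : bounded_mfun f -> E (fun y => a * f y) = a * E f.
Proof.
by move=> bf; rewrite /E RintegralZl//; exact: bounded_mfun_integrable.
Qed.

(** Every S h / E (S h), with h >= 0 of positive integral, lies between these two
constants; so the iterates stay bounded, and bounded away from 0. *)
Let normal f := [/\ bounded_mfun f, E f = 1 &
  forall x, m / (M * V) <= f x <= M / (m * V)].

Let normalize f : T -> R := fun x => (E (S f))^-1 * S f x.

Let f_ n := iter n normalize (fun=> V^-1).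

Let normal_ge0 f : normal f -> forall x, 0 <= f x.
Proof.
move=> [_ _ fb] x; have /andP[+ _] := fb x; apply: le_trans.
by rewrite divr_ge0 ?mulr_ge0// ltW.
Qed.

Let S_normal f : normal f -> forall x, m <= S f x <= M.
Proof.
move=> nf x; have f0 := normal_ge0 nf; case: nf => bf Ef _.
by have := S_ge bf f0 x; have := S_le bf f0 x;
  rewrite -/(E f) Ef !mulr1 => -> ->.
Qed.

Let E_S_normal f : normal f -> m * V <= E (S f) <= M * V.
Proof.
move=> nf; have bf : bounded_mfun (S f) by apply: S_bounded; case: nf.
rewrite -2!E_cst; apply/andP; split; apply: ler_Rintegral => //.
- exact: bounded_mfun_cst.
- by move=> x; have /andP[] := S_normal nf x.
- exact: bounded_mfun_cst.
- by move=> x; have /andP[] := S_normal nf x.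
Qed.

Let E_S_gt0 f : normal f -> 0 < E (S f).
Proof.
by move=> /E_S_normal/andP[+ _]; apply: lt_le_trans; rewrite mulr_gt0.
Qed.

Let normal_normalize f : normal f -> normal (normalize f).
Proof.
move=> nf; have bf : bounded_mfun (S f) by apply: S_bounded; case: nf.
have l0 := E_S_gt0 nf; split.
- exact: bounded_mfunZ.
- by rewrite E_scale// mulVf// gt_eqF.
- move=> x; have /andP[lm lM] := E_S_normal nf.
  have /andP[sm sM] := S_normal nf x; rewrite /normalize [_^-1 * _]mulrC.
  have mV0 : 0 < m * V by rewrite mulr_gt0.
  have Sf0 : 0 <= S f x by exact: le_trans (ltW m_gt0) sm.
  apply/andP; split; apply: ler_pM => //; rewrite ?invr_ge0 ?(ltW m_gt0)//.
  + by rewrite mulr_ge0// ltW.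
  + by rewrite lef_pV2 ?posrE ?mulr_gt0.
  + exact: ltW.
  + by rewrite lef_pV2 ?posrE.
Qed.

Let normal_f n : normal (f_ n).
Proof.
elim: n => [|n IH]; last exact: normal_normalize.
split; first exact: bounded_mfun_cst.
  by rewrite E_cst mulVf// gt_eqF.
move=> x /=; rewrite !invfM !mulrA; apply/andP; split.
  by rewrite ler_piMl ?invr_ge0 ?(ltW mu_gt0)// ler_pdivrMr// mul1r.
by rewrite ler_peMl ?invr_ge0 ?(ltW mu_gt0)// ler_pdivlMr// mul1r.
Qed.

Let enclosed (f : T -> R) (al be : R) :=
  forall x, al * f x <= S f x <= be * f x.

Let enclosed_E f al be : normal f -> enclosed f al be ->
  al <= E (S f) <= be.
Proof.
move=> [bf Ef _] fe; have bS := S_bounded bf.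
have Ez c : E (fun x => c * f x) = c by rewrite E_scale// Ef mulr1.
rewrite -[al]Ez -[be]Ez.
by apply/andP; split; apply: ler_Rintegral => //; try exact: bounded_mfunZ;
  move=> x; have /andP[] := fe x.
Qed.

Let r : R := 1 - m / M.

Let r_bounds : 0 <= r < 1.
Proof.
by rewrite /r subr_ge0 ler_pdivrMr// mul1r m_le_M ltrBlDr ltrDl divr_gt0.
Qed.

(** Birkhoff contraction. As E f = 1, the integral of S f - al * f is l - al with
l = E (S f), and S f <= M. Hence
S (S f) - al * S f >= m * (l - al) >= m / M * (l - al) * S f: the lower
constant rises by m / M * (l - al). Symmetrically the upper one drops by
m / M * (be - l), and the gap loses m / M * (be - al) in total. *)
Let gap_contracts f al be : normal f -> enclosed f al be ->
  exists al' be', enclosed (normalize f) al' be' /\ be' - al' = r * (be - al).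
Proof.
move=> nf fe; have /andP[all lbe] := enclosed_E nf fe.
have [bf Ef _] := nf; have bS := S_bounded bf; have l0 := E_S_gt0 nf.
set l := E (S f) in all lbe l0 *.
exists (al + m / M * (l - al)), (be - m / M * (be - l)).
split; last by rewrite /r; ring.
move=> x; rewrite /normalize -/l S_scale// !(mulrCA _ l^-1).
rewrite !ler_pM2l ?invr_gt0//.
have /andP[_ sM] := S_normal nf x.
have mM c : 0 <= c -> m / M * c * S f x <= m * c.
  move=> c0; rewrite [leLHS](_ : _ = m * c * (S f x / M)); last by ring.
  by rewrite ler_piMr ?mulr_ge0 ?(ltW m_gt0)// ler_pdivrMr// mul1r.
have := mM (l - al); have := mM (be - l); rewrite !subr_ge0.
move=> /(_ lbe) bu /(_ all) bl.
have bbf : bounded_mfun (fun y => be * f y) by exact: bounded_mfunZ.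
have h0 y : 0 <= be * f y - 1 * S f y.
  by rewrite mul1r subr_ge0; have /andP[] := fe y.
have h1 y : 0 <= S f y - al * f y by rewrite subr_ge0; have /andP[] := fe y.
have := S_ge (bounded_mfunB bbf (bounded_mfunZ 1 bS)) h0 x.
have := S_ge (bounded_mfunB bS (bounded_mfunZ al bf)) h1 x.
rewrite -!/(E _) S_comb// S_comb// E_comb// E_comb//.
rewrite S_scale// E_scale// -/l Ef mulr1 !mul1r => lb ub.
rewrite mulrDl mulrBl; lra.
Qed.

Let gap_f : exists B, forall n, exists al be,
  enclosed (f_ n) al be /\ be - al = B * r ^+ n.
Proof.
exists (M * V - m * V); elim=> [|n [al [be [fe gap]]]].
  exists (m * V), (M * V); split; last by rewrite expr0 mulr1.
  move=> x; rewrite -!mulrA mulfV ?gt_eqF// !mulr1.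
  exact: S_normal (normal_f 0%N) x.
have [al' [be' [fe' gap']]] := gap_contracts (normal_f n) fe.
by exists al', be'; split => //; rewrite gap' gap exprS; ring.
Qed.

Let E_dist f g C : bounded_mfun f -> bounded_mfun g ->
  (forall x, `|f x - g x| <= C) -> `|E f - E g| <= C * V.
Proof.
move=> bf bg fgC; rewrite -[E g]mul1r -E_comb// -E_cst.
have bfg := bounded_mfunB bf (bounded_mfunZ 1 bg).
apply: le_trans (le_normr_Rintegral _ _) _ => //.
  exact: bounded_mfun_integrable.
apply: ler_Rintegral; [exact: bounded_mfun_norm|exact: bounded_mfun_cst|].
by move=> x; rewrite mul1r.
Qed.

Let S_dist f g C : bounded_mfun f -> bounded_mfun g ->
  (forall x, `|f x - g x| <= C) ->
  forall x, `|S f x - S g x| <= M * (C * V).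
Proof.
move=> bf bg fgC x.
have C0 : 0 <= C by exact: le_trans (normr_ge0 _) (fgC point).
have one_sided u v : bounded_mfun u -> bounded_mfun v ->
    (forall y, u y - v y <= C) -> S u x - S v x <= M * (C * V).
  move=> bu bv uvC; have bC := @bounded_mfun_cst _ T R C.
  have buv := bounded_mfunB bu (bounded_mfunZ 1 bv).
  have h0 y : 0 <= C - 1 * (u y - 1 * v y) by rewrite !mul1r subr_ge0.
  have := S_ge (bounded_mfunB bC (bounded_mfunZ 1 buv)) h0 x.
  have E0 : 0 <= E (fun y => C - 1 * (u y - 1 * v y)) by exact: Rintegral_ge0.
  move=> /(le_trans (mulr_ge0 (ltW m_gt0) E0)).
  rewrite !S_comb// !mul1r; have := S_le bC (fun=> C0) x.
  by rewrite -/(E _) E_cst; lra.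
rewrite ler_norml lerNl opprB !one_sided// => y.
  exact: le_trans (ler_norm _) (fgC y).
by apply: le_trans (ler_norm _) _; rewrite distrC.
Qed.

(** Since E f_n = 1, the constant E (S f_n) lies between any al and be enclosing
S f_n / f_n; so f_n nearly solves the eigenvalue equation, with an error of the
order of the gap, and the same estimate makes f_n a Cauchy sequence. *)
Lemma exists_positive_eigenfunction : exists nu g,
  [/\ 0 < nu, bounded_mfun g, forall x, 0 < g x & forall x, S g x = nu * g x].
Proof.
have [B gB] := gap_f; have /andP[r0 r1] := r_bounds.
have mV0 : 0 < m * V by rewrite mulr_gt0.
pose hi := M / (m * V); pose lo := m / (M * V); pose l n := E (S (f_ n)).
have lo0 : 0 < lo by rewrite divr_gt0// mulr_gt0.
have bf n : bounded_mfun (f_ n) by case: (normal_f n).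
have residual n x : `|S (f_ n) x - l n * f_ n x| <= B * hi * r ^+ n.
  have [al [be [fe gap]]] := gB n.
  have /andP[all lbe] := enclosed_E (normal_f n) fe.
  have f0 := normal_ge0 (normal_f n) x.
  have [_ _ /(_ x)/andP[_ fhi]] := normal_f n.
  have : `|S (f_ n) x - l n * f_ n x| <= (be - al) * f_ n x.
    have /andP[ae eb] := fe x.
    have := ler_wpM2r f0 all; have := ler_wpM2r f0 lbe;
      rewrite -/(l n) => L1 L2.
    by rewrite ler_norml mulrBl; apply/andP; split; lra.
  move/le_trans; apply; rewrite mulrAC -gap ler_wpM2l// subr_ge0.
  exact: le_trans lbe.
have B0 : 0 <= B * hi.
  by have := le_trans (normr_ge0 _) (residual 0%N point); rewrite expr0 mulr1.
have step x n : `|f_ n.+1 x - f_ n x| <= B * hi / (m * V) * r ^+ n.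
  have l0 := E_S_gt0 (normal_f n); have /andP[mVl _] := E_S_normal (normal_f n).
  have -> : f_ n.+1 x - f_ n x = (S (f_ n) x - l n * f_ n x) / l n.
    by rewrite /= /normalize -/(l n); field; rewrite gt_eqF.
  rewrite normrM normfV (gtr0_norm l0) mulrAC.
  by apply: ler_pM => //; rewrite ?invr_ge0 ?(ltW l0)// lef_pV2 ?posrE.
pose G := B * hi / (m * V) / (1 - r).
have /choice[g fg] : forall x, exists y, forall n, `|f_ n x - y| <= G * r ^+ n.
  by move=> x; apply: geometric_cauchy_limit (step x).
have bg : bounded_mfun g.
  by apply: (@bounded_mfun_limit _ _ _ f_ g r G) => // n x; exact: fg.
have glo x : lo <= g x.
  rewrite -subr_le0; apply: (geometric_le0 r_bounds) => n.
  have [_ _ /(_ x)/andP[flo _]] := normal_f n.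
  apply: le_trans (fg x n); apply: le_trans (ler_norm _).
  by rewrite lerB.
have g0 x : 0 < g x by exact: lt_le_trans (glo x).
have Sfg n := S_dist (bf n) bg (fun x => fg x n).
(* the eigenvalue is the limit of the normalising constants *)
pose nu := E (S g).
have lnu n : `|l n - nu| <= M * (G * r ^+ n * V) * V.
  by apply: E_dist (Sfg n); exact: S_bounded.
have [_ [gmax gle]] := bg.
have Sg x : S g x = nu * g x.
  apply/eqP; rewrite -subr_eq0 -normr_le0; apply: (geometric_le0 r_bounds
    (C := M * (G * V) + B * hi + M * V * G + M * (G * V) * V * gmax)) => n.
  have -> : S g x - nu * g x = (S g x - S (f_ n) x)
      + (S (f_ n) x - l n * f_ n x) + l n * (f_ n x - g x)
      + (l n - nu) * g x by ring.
  have e1 : `|S g x - S (f_ n) x| <= M * (G * r ^+ n * V).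
    by rewrite distrC.
  have e2 := residual n x.
  have e3 : `|l n * (f_ n x - g x)| <= M * V * (G * r ^+ n).
    have /andP[_ lM] := E_S_normal (normal_f n).
    by rewrite normrM ler_pM// gtr0_norm// (E_S_gt0 (normal_f n)).
  have e4 : `|(l n - nu) * g x| <= M * (G * r ^+ n * V) * V * gmax.
    by rewrite normrM ler_pM.
  rewrite [leRHS](_ : _ = M * (G * r ^+ n * V) + B * hi * r ^+ n
    + M * V * (G * r ^+ n) + M * (G * r ^+ n * V) * V * gmax); last by ring.
  apply: le_trans (ler_normD _ _) _; apply: lerD => //.
  apply: le_trans (ler_normD _ _) _; apply: lerD => //.
  by apply: le_trans (ler_normD _ _) _; apply: lerD.
exists nu, g; split => //.
have : 0 < nu * g point.
  rewrite -Sg; have := S_ge bg (fun x => ltW (g0 x)) point; apply: lt_le_trans.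
  rewrite mulr_gt0// -/(E g); apply: (@lt_le_trans _ _ (lo * V)).
    by rewrite mulr_gt0.
  by rewrite -E_cst; apply: ler_Rintegral => //; exact: bounded_mfun_cst.
by rewrite pmulr_lgt0.
Qed.
End positive_eigenfunction.

(** * Integral operators with a bounded nonnegative kernel *)

Section kernel_operator.
Context d (T : measurableType d) (R : realType).
Variable mu : {finite_measure set T -> \bar R}.

Let section1 (F : T * T -> R) x :
  bounded_mfun F -> bounded_mfun (fun y => F (x, y)).
Proof.
move=> [mF [B FB]]; split; last by exists B.
exact: measurableT_comp.
Qed.

Let section2 (F : T * T -> R) y :
  bounded_mfun F -> bounded_mfun (fun x => F (x, y)).
Proof.
move=> [mF [B FB]]; split; last by exists B.
exact: measurableT_comp.
Qed.

Let Rintegral_fineK (f : T -> R) : bounded_mfun f ->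
  (\int[mu]_x f x)%:E = (\int[mu]_x (f x)%:E)%E.
Proof.
move=> bf; rewrite fineK//.
by apply: integrable_fin_num => //; exact: bounded_mfun_integrable.
Qed.

Let integrable_prod (F : T * T -> R) : bounded_mfun F ->
  (mu \x mu)%E.-integrable setT (EFin \o F).
Proof.
move=> [mF [B FB]]; apply: measurable_bounded_integrable => //.
  rewrite [ltLHS](_ : _ = mu setT * mu setT)%E.
    by rewrite -ge0_fin_numE ?mule_ge0// fin_numM// fin_num_measure.
  by rewrite -[setT]setXTT; exact: product_measure1E.
exists B; split; first exact: num_real.
by move=> x Bx t _; exact: le_trans (FB t) (ltW Bx).
Qed.

Lemma bounded_mfun_Rintegral (F : T * T -> R) :
  bounded_mfun F -> bounded_mfun (fun x => \int[mu]_y F (x, y)).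
Proof.
move=> bF; have [mF [B FB]] := bF; split.
  apply: measurableT_comp => //.
  apply: (@measurable_fubini_F _ _ T T R mu mu (EFin \o F)).
  exact: integrable_prod.
exists (B * fine (mu setT)) => x.
rewrite -(Rintegral_cst mu)//; apply: le_trans (le_normr_Rintegral _ _) _ => //.
  by apply: bounded_mfun_integrable; exact: section1.
apply: ler_Rintegral; last by move=> y; exact: FB.
  by apply: bounded_mfun_norm; exact: section1.
exact: bounded_mfun_cst.
Qed.

Lemma Rintegral_exchange (F : T * T -> R) : bounded_mfun F ->
  \int[mu]_x \int[mu]_y F (x, y) = \int[mu]_y \int[mu]_x F (x, y).
Proof.
move=> bF; congr fine.
under eq_integral => x _ do rewrite (Rintegral_fineK (section1 x bF)).
under [RHS]eq_integral => y _ do rewrite (Rintegral_fineK (section2 y bF)).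
apply: (@Fubini _ _ _ _ _ mu mu (EFin \o F)).
exact: integrable_prod.
Qed.

Definition kernel_op (k : T * T -> R) (f : T -> R) x :=
  \int[mu]_y (k (x, y) * f y).

Variables (k : T * T -> R) (K m : R).
Hypothesis mk : measurable_fun setT k.
Hypothesis k_ge0 : forall z, 0 <= k z.
Hypothesis k_le : forall z, k z <= K.

Let bk : bounded_mfun k.
Proof. by split=> //; exists K => z; rewrite ger0_norm. Qed.

Lemma kernel_op_linear a b f g : bounded_mfun f -> bounded_mfun g ->
  kernel_op k (fun x => a * f x + b * g x) =1
  fun x => a * kernel_op k f x + b * kernel_op k g x.
Proof.
move=> bf bg x; rewrite /kernel_op.
rewrite -Rintegral_linear//; try by apply: bounded_mfunM => //; exact: section1.
by congr (Rintegral _ _ _); apply/funext => y; ring.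
Qed.

Lemma bounded_mfun_kernel_op f : bounded_mfun f -> bounded_mfun (kernel_op k f).
Proof.
move=> bf; apply: (@bounded_mfun_Rintegral (fun z => k z * f z.2)).
by apply: bounded_mfunM => //; exact: (bounded_mfun_comp measurable_snd).
Qed.

Lemma kernel_op_ge0 f : (forall x, 0 <= f x) -> forall x, 0 <= kernel_op k f x.
Proof. by move=> f0 x; apply: Rintegral_ge0 => y _; rewrite mulr_ge0. Qed.

Lemma kernel_op_le f : bounded_mfun f -> (forall x, 0 <= f x) ->
  forall x, kernel_op k f x <= K * \int[mu]_y f y.
Proof.
move=> bf f0 x; rewrite -RintegralZl//; last exact: bounded_mfun_integrable.
apply: ler_Rintegral; last by move=> y; rewrite ler_wpM2r.
  by apply: bounded_mfunM => //; exact: section1.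
exact: bounded_mfunZ.
Qed.

Hypothesis k2_ge : forall x y, m <= \int[mu]_z (k (x, z) * k (z, y)).

(** By Fubini, [kernel_op k] applied twice is the integral operator whose kernel
is the integral in [k2_ge]. *)
Lemma kernel_op2_ge f : bounded_mfun f -> (forall x, 0 <= f x) ->
  forall x, m * \int[mu]_y f y <= kernel_op k (kernel_op k f) x.
Proof.
move=> bf f0 x; have bi h : bounded_mfun h -> mu.-integrable setT (EFin \o h).
  exact: bounded_mfun_integrable.
have bkx := section1 x bk.
pose F (z : T * T) := k (x, z.1) * (k z * f z.2).
have bF : bounded_mfun F.
  apply: bounded_mfunM; first exact: (bounded_mfun_comp measurable_fst bkx).
  by apply: bounded_mfunM => //; exact: (bounded_mfun_comp measurable_snd).
rewrite [leRHS](_ : _ = \int[mu]_z \int[mu]_y F (z, y)); last first.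
  congr (Rintegral _ _ _); apply/funext => z; rewrite -RintegralZl//.
  by apply: bi; apply: bounded_mfunM => //; exact: section1.
rewrite Rintegral_exchange// [leRHS](_ : _ =
    \int[mu]_y ((\int[mu]_z (k (x, z) * k (z, y))) * f y)); last first.
  congr (Rintegral _ _ _); apply/funext => y; rewrite -RintegralZr//.
    by congr (Rintegral _ _ _); apply/funext => z; rewrite /F/= mulrA.
  by apply: bi; apply: bounded_mfunM => //; exact: section2.
rewrite -RintegralZl//; last exact: bi.
apply: ler_Rintegral; first exact: bounded_mfunZ; last first.
  by move=> y; rewrite ler_wpM2r.
apply: bounded_mfunM => //.
apply: (@bounded_mfun_Rintegral (fun w => k (x, w.2) * k (w.2, w.1))).
apply: bounded_mfunM; first exact: (bounded_mfun_comp measurable_snd bkx).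
exact: (bounded_mfun_comp (@measurable_swap _ _ T T) bk).
Qed.

(** If T (T g) = nu * g then T maps T g + sqrt nu * g to sqrt nu times itself;
positivity of g rules out that this function is zero. *)
Theorem exists_positive_kernel_eigenfunction :
  0 < fine (mu setT) -> 0 < m -> exists lambda f,
  [/\ 0 < lambda, bounded_mfun f, forall x, 0 < f x &
      forall x, kernel_op k f x = lambda * f x].
Proof.
move=> mu0 m0; set V := fine (mu setT) in mu0.
have K0 : 0 <= K by exact: le_trans (k_ge0 point) (k_le point).
pose S f := kernel_op k (kernel_op k f).
have bop := bounded_mfun_kernel_op.
have bS f : bounded_mfun f -> bounded_mfun (S f) by move=> bf; exact/bop/bop.
have S_linear a b f g : bounded_mfun f -> bounded_mfun g ->
    S (fun x => a * f x + b * g x) =1 fun x => a * S f x + b * S g x.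
  move=> bf bg x; rewrite /S -kernel_op_linear; try exact: bop.
  by congr (kernel_op k _ x); apply/funext => y; rewrite kernel_op_linear.
have S_le f : bounded_mfun f -> (forall x, 0 <= f x) ->
    forall x, S f x <= K * (K * V) * \int[mu]_y f y.
  move=> bf f0 x; apply: le_trans (kernel_op_le (bop _ bf) _ x) _.
    exact: kernel_op_ge0.
  rewrite -mulrA ler_wpM2l//.
  rewrite [leRHS](_ : _ = K * (\int[mu]_y f y) * V); last by ring.
  rewrite -(Rintegral_cst mu)//; apply: ler_Rintegral; first exact: bop.
    exact: bounded_mfun_cst.
  by move=> z; exact: kernel_op_le.
have [nu [g [nu0 bg g0 Sg]]] := exists_positive_eigenfunction
  mu0 m0 bS S_linear kernel_op2_ge S_le.
have s0 : 0 < Num.sqrt nu by rewrite sqrtr_gt0.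
exists (Num.sqrt nu), (fun x => 1 * kernel_op k g x + Num.sqrt nu * g x).
split=> //.
- apply: bounded_mfunD; apply: bounded_mfunZ => //; exact: bop.
- move=> x; rewrite mul1r ltr_wpDl ?mulr_gt0//.
  by apply: kernel_op_ge0 => y; exact: ltW.
- move=> x; rewrite kernel_op_linear//; last exact: bop.
  by rewrite -/(S g x) Sg -{1}(sqr_sqrtr (ltW nu0)); ring.
Qed.

End kernel_operator.

(** * The kernel |x - y|^rho on [-a, a] *)

Section riesz_kernel.
Context {R : realType}.

Let leb_lty (a : R) : (lebesgue_measure `[(- a)%R, a] < +oo)%E.
Proof. by rewrite lebesgue_measure_itv/=; case: ifP => _; rewrite ltry. Qed.

(** The measure [leb a] again, with a canonical structure of finite measure. *)
Definition finite_leb (a : R) :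
    {finite_measure set (measurableTypeR R) -> \bar R} :=
  @mfrestr _ (measurableTypeR R) R `[- a, a]%classic lebesgue_measure
    (measurable_itv `[- a, a]) (leb_lty a).

Lemma leb_setT (a : R) : 0 < a -> leb a setT = (2 * a)%:E.
Proof.
move=> a0; rewrite /leb /= /mrestr setTI lebesgue_measure_itv/= lte_fin.
by rewrite ifT; [rewrite -EFinD; congr EFin; ring|lra].
Qed.

Lemma finite_leb_setT (a : R) : 0 < a -> finite_leb a setT = (2 * a)%:E.
Proof. exact: leb_setT. Qed.

Lemma Rintegral_finite_leb (a : R) (f : measurableTypeR R -> R) :
  bounded_mfun f ->
  \int[finite_leb a]_x f x = \int[lebesgue_measure]_(x in `[- a, a]) f x.
Proof.
move=> bf; congr fine; set D := [set` `[- a, a]].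
have mD : measurable D by exact: measurable_itv.
rewrite (@negligible_integral _ _ _ (finite_leb a) setT (~` D))//.
- rewrite setTD setCK; apply: eq_measure_integral => A mA AD.
  by rewrite /= /mfrestr /mrestr setIidl.
- exact: measurableC.
- exact: (@bounded_mfun_integrable _ _ _ (finite_leb a)).
- by rewrite /= /mfrestr /mrestr setICl measure0.
Qed.

Variables (a rho : R).
Hypotheses (a0 : 0 < a) (rho0 : 0 < rho).

(** Truncating the distance at 2a changes nothing on [-a, a] and makes the
kernel bounded on the whole plane. *)
Definition riesz_kernel (z : measurableTypeR R * measurableTypeR R) : R :=
  Num.min `|z.1 - z.2| (2 * a) `^ rho.

Let gap_ge0 (u : R) : 0 <= Num.min `|u| (2 * a).
Proof. by rewrite le_min normr_ge0 mulr_ge0// ltW. Qed.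

Let riesz_kernel_mono (u v : R) : 0 <= u -> u <= v -> u `^ rho <= v `^ rho.
Proof.
by move=> u0 uv; apply: ge0_ler_powR => //; rewrite ?nnegrE ?(ltW rho0)//;
  exact: le_trans uv.
Qed.

Let measurable_riesz_kernel : measurable_fun setT riesz_kernel.
Proof.
apply: (measurableT_comp (@measurable_powR R rho)).
apply: measurable_minr; last exact: measurable_cst.
apply: (measurableT_comp (@normr_measurable R setT)).
by apply: measurable_funB; [exact: measurable_fst|exact: measurable_snd].
Qed.

Let riesz_kernel_ge0 z : 0 <= riesz_kernel z.
Proof. exact: powR_ge0. Qed.

Let riesz_kernel_le z : riesz_kernel z <= (2 * a) `^ rho.
Proof. by apply: riesz_kernel_mono => //; rewrite ge_min lexx orbT. Qed.

Let bounded_riesz_kernel : bounded_mfun riesz_kernel.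
Proof. by split=> //; exists ((2 * a) `^ rho) => z; rewrite ger0_norm. Qed.

Let riesz_kernelE x y : `[- a, a]%classic x -> `[- a, a]%classic y ->
  riesz_kernel (x, y) = `|x - y| `^ rho.
Proof.
rewrite /= !in_itv/= => /andP[ax xa] /andP[ay ya].
rewrite /riesz_kernel min_l// ler_norml; apply/andP; split=> /=; lra.
Qed.

Let finite_leb_ball (x delta : R) : 0 < delta ->
  fine (finite_leb a `[x - delta, x + delta]%classic) <= 2 * delta.
Proof.
move=> d0; have mB : measurable (`[x - delta, x + delta]%classic : set
  (measurableTypeR R)) by exact: measurable_itv.
have massB : lebesgue_measure `[x - delta, x + delta]%classic = (2 * delta)%:E.
  rewrite lebesgue_measure_itv/= lte_fin ifT; last lra.
  by rewrite -EFinD/=; congr EFin; ring.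
rewrite -lee_fin fineK ?fin_num_measure// -massB.
by apply: le_measure; rewrite ?inE//; exact: measurableI.
Qed.

Let kernel_ge_away (x z delta : R) : 0 < delta <= 2 * a ->
  z \notin `[x - delta, x + delta] ->
  delta `^ rho <= riesz_kernel (x, z) /\ delta `^ rho <= riesz_kernel (z, x).
Proof.
move=> /andP[d0 d2a]; rewrite in_itv/= negb_and -!ltNge => away.
have dxz : delta <= `|x - z|.
  case/orP : away => xz.
    by apply: le_trans (ler_norm _); lra.
  by rewrite distrC; apply: le_trans (ler_norm _); lra.
by rewrite /riesz_kernel/= (distrC z); split;
  apply: riesz_kernel_mono; rewrite ?(ltW d0)// le_min dxz.
Qed.

(** Both factors are at least delta^rho unless z lies in the ball of radius
delta around x or around y. The two balls have total mass at most 4 * delta = a,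
half of the mass of [-a, a]. *)
Let riesz_kernel2_ge delta x y : 4 * delta = a ->
  (delta `^ rho * delta `^ rho) * a <=
  \int[finite_leb a]_z (riesz_kernel (x, z) * riesz_kernel (z, y)).
Proof.
move=> deltaE; have a_gt0 := a0; have d0 : 0 < delta by lra.
have d2a : 0 < delta <= 2 * a by rewrite d0/=; lra.
set c := delta `^ rho * delta `^ rho.
pose B (u : R) : set (measurableTypeR R) := `[u - delta, u + delta]%classic.
have c0 : 0 <= c by rewrite mulr_ge0 ?powR_ge0.
have bB u : bounded_mfun (\1_(B u) : measurableTypeR R -> R).
  split; first by apply: measurable_indic; exact: measurable_itv.
  by exists 1 => z; rewrite indicE; case: (_ \in _); rewrite ?normr1 ?normr0.
have bBB := bounded_mfunD (bB x) (bB y).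
have b1 := @bounded_mfun_cst _ (measurableTypeR R) R 1.
apply: (@le_trans _ _
    (\int[finite_leb a]_z (c * (1 - (\1_(B x) z + \1_(B y) z))))).
  have ib f : bounded_mfun f -> (finite_leb a).-integrable setT (EFin \o f).
    exact: bounded_mfun_integrable.
  rewrite RintegralZl//; last by apply: ib; exact: bounded_mfunB.
  rewrite RintegralB//; [|exact: ib|exact: ib].
  rewrite RintegralD//; [|exact: ib|exact: ib].
  have -> : \int[finite_leb a]_x 1 = 2 * a.
    by rewrite Rintegral_cst// mul1r (congr1 fine (finite_leb_setT a0)).
  rewrite ler_wpM2l//.
  have I u : \int[finite_leb a]_z \1_(B u) z <= 2 * delta.
    rewrite /Rintegral integral_indic//; last exact: measurable_itv.
    by rewrite setIT; exact: finite_leb_ball.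
  have := I x; have := I y; lra.
apply: ler_Rintegral.
- by apply: bounded_mfunZ; exact: bounded_mfunB.
- apply: bounded_mfunM.
    by apply: (bounded_mfun_comp _ bounded_riesz_kernel);
      exact: measurable_fun_pair.
  by apply: (bounded_mfun_comp _ bounded_riesz_kernel);
      exact: measurable_fun_pair.
- move=> z; rewrite !indicE.
  have k0 := mulr_ge0 (riesz_kernel_ge0 (x, z)) (riesz_kernel_ge0 (z, y)).
  have [xz|xz] := boolP (z \in B x).
    apply: le_trans k0; rewrite mulr_ge0_le0//.
    by case: (z \in B y) => /=; lra.
  have [yz|yz] := boolP (z \in B y).
    by apply: le_trans k0; rewrite mulr_ge0_le0//= addrC subrr.
  rewrite addr0 subr0 mulr1; apply: ler_pM; rewrite ?powR_ge0//.
    by apply: (kernel_ge_away d2a _).1; move: xz; rewrite /B mem_setE.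
  by apply: (kernel_ge_away d2a _).2; move: yz; rewrite /B mem_setE.
Qed.

Lemma riesz_positive_eigenfunction : exists lambda (f : measurableTypeR R -> R),
  [/\ 0 < lambda, bounded_mfun f, forall x, 0 < f x &
      forall x, `[- a, a]%classic x ->
        \int[lebesgue_measure]_(y in `[- a, a]) (`|x - y| `^ rho * f y)
        = lambda * f x].
Proof.
have V0 : 0 < fine (finite_leb a setT) by rewrite finite_leb_setT//= mulr_gt0.
have m0 : 0 < ((a / 4) `^ rho * (a / 4) `^ rho) * a.
  by rewrite !mulr_gt0// powR_gt0// divr_gt0.
have delta4 : 4 * (a / 4) = a by field.
have k2 x y := riesz_kernel2_ge x y delta4.
have [lambda [f [l0 bf f0 kf]]] := exists_positive_kernel_eigenfunction
  measurable_riesz_kernel riesz_kernel_ge0 riesz_kernel_le k2 V0 m0.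
exists lambda, f; split=> // x Dx; rewrite -kf /kernel_op Rintegral_finite_leb.
  by apply: eq_Rintegral => y /set_mem Dy; rewrite riesz_kernelE.
apply: bounded_mfunM => //.
by apply: (bounded_mfun_comp _ bounded_riesz_kernel);
      exact: measurable_fun_pair.
Qed.

End riesz_kernel.

(** * The sign of the constant *)

Section riesz_constant.
Context {R : realType}.

Lemma integrable_expRN (c : R) : 0 < c ->
  lebesgue_measure.-integrable `]0, +oo[
    (EFin \o (fun t : R => expR (- (c * t)))).
Proof.
move=> c0.
have ie : lebesgue_measure.-integrable setT (EFin \o exponential_pdf c).
  apply/integrableP; split.
    by apply/measurable_EFinP; exact: measurable_exponential_pdf.
  under eq_integral => x _ do
    rewrite /= ger0_norm ?(exponential_pdf_ge0 (ltW c0))//.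
  by rewrite integral_exponential_pdf// ltry.
have mD : measurable (`]0, +oo[%classic : set (measurableTypeR R)).
  exact: measurable_itv.
have := integrableZl mD c^-1 (integrableS measurableT mD (@subsetT _ _) ie).
apply: eq_integrable => // x; rewrite inE/= in_itv/= andbT => x0.
by rewrite exponential_pdfE ?ltW// -EFinM mulKf ?gt_eqF// mulNr.
Qed.

(** A divergent integral would make [Gamma] equal to 0 by convention, so
integrability comes first: t^rho <= 1 + t <= 2 exp (t / 2). Positivity is then
read off on [1, 2], where the integrand is at least exp (-2). *)
Lemma Gamma_1D_gt0 (rho : R) : 0 < rho -> rho <= 1 -> 0 < Gamma (1 + rho).
Proof.
move=> rho0 rho1; rewrite /Gamma.
have one s : 1 `^ s = 1 :> R by rewrite powR1.
set D : set (measurableTypeR R) := `]0, +oo[%classic.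
pose g (t : measurableTypeR R) : R := t `^ (1 + rho - 1) * expR (- t).
have mD : measurable D by exact: measurable_itv.
have mg : measurable_fun setT g.
  apply: measurable_funM; first exact: measurable_powR.
  by apply: measurableT_comp => //; exact: measurable_funN.
have g0 t : 0 <= g t by rewrite mulr_ge0 ?powR_ge0 ?expR_ge0.
have ig : lebesgue_measure.-integrable D (EFin \o g).
  have half_gt0 : 0 < 2^-1 :> R by lra.
  have i2 := integrableZl mD 2 (integrable_expRN half_gt0).
  apply: le_integrable i2 => //.
    by apply/measurable_EFinP; exact: measurable_funTS.
  move=> t; rewrite /D/= in_itv/= andbT => t0; rewrite /= lee_fin ger0_norm//.
  rewrite ger0_norm ?mulr_ge0 ?expR_ge0//.
  have tr : t `^ (1 + rho - 1) <= 1 + t.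
    rewrite addrAC subrr add0r; have [t1|t1] := leP t 1.
      apply: (@le_trans _ _ 1); last lra.
      rewrite -(one rho); apply: ge0_ler_powR; rewrite ?nnegrE//; lra.
    apply: (@le_trans _ _ (t `^ 1)); first by apply: ler_powR => //; lra.
    by rewrite powRr1; lra.
  have e2 : 1 + t <= 2 * expR (2^-1 * t).
    have := expR_ge1Dx (2^-1 * t); lra.
  have -> : expR (- (2^-1 * t)) = expR (2^-1 * t) * expR (- t).
    by rewrite -expRD; congr expR; lra.
  by rewrite mulrA ler_wpM2r ?expR_ge0// (le_trans tr).
apply: (@lt_le_trans _ _
    (\int[lebesgue_measure]_(t in `[1, 2]) expR (- 2 : R))).
  rewrite Rintegral_cst; last exact: measurable_itv.
  rewrite mulr_gt0 ?expR_gt0//.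
  rewrite /= lebesgue_measure_itv/= lte_fin ifT; last lra.
  by rewrite -EFinD/=; lra.
have sD : (`[1, 2]%classic : set (measurableTypeR R)) `<=` D.
  by move=> t; rewrite /D/= !in_itv/= andbT => /andP[t1 _]; lra.
have m12 : measurable (`[1, 2]%classic : set (measurableTypeR R)).
  exact: measurable_itv.
have i12 : lebesgue_measure.-integrable `[1, 2]
    (EFin \o (fun=> expR (- 2 : R))).
  apply: measurable_bounded_integrable => //.
    by rewrite /= lebesgue_measure_itv/=; case: ifP => _; rewrite ltry.
  exists (expR (-2)); split; first exact: num_real.
  by move=> x ex t _ /=; rewrite ger0_norm ?expR_ge0// ltW.
apply: (@le_trans _ _ (\int[lebesgue_measure]_(t in `[1, 2]) g t)).
  apply: le_Rintegral => //; first exact: integrableS ig.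
  move=> t; rewrite /= in_itv/= => /andP[t1 t2].
  rewrite /g -[leLHS]mul1r.
  apply: ler_pM; rewrite ?expR_ge0// ?ler_expR; last lra.
  rewrite -[leLHS](one (1 + rho - 1)); apply: ge0_ler_powR; rewrite ?nnegrE//;
    lra.
rewrite /Rintegral; apply: fine_le.
- by apply: integrable_fin_num => //; exact: integrableS ig.
- exact: integrable_fin_num.
- apply: ge0_subset_integral => //.
    by apply/measurable_EFinP; exact: measurable_funTS.
  by move=> t _; rewrite lee_fin.
Qed.

Lemma Criesz_lt0 (rho : R) : 0 < rho -> rho <= 1 -> Criesz rho < 0.
Proof.
move=> rho0 rho1; rewrite /Criesz mulNr oppr_lt0 divr_gt0// !mulr_gt0//.
  exact: Gamma_1D_gt0.
have p0 := pi_gt0 R; apply: sin_gt0_pi; rewrite divr_gt0 ?mulr_gt0//=.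
rewrite ltr_pdivrMr// ltr_pM2l//; lra.
Qed.

End riesz_constant.

(** * The eigenfunction in L^2 *)

Lemma bounded_mfun_L2 (R : realType) (a : R) (f : measurableTypeR R -> R) :
  bounded_mfun f -> f \in Lfun (leb a) 2%:E.
Proof.
move=> [mf [B fB]]; rewrite inE; apply/andP; split; rewrite inE//=.
rewrite /finite_norm unlock /Lnorm poweR_lty//.
rewrite (_ : integral _ _ _ = \int[leb a]_x (`|f x| `^ 2)%:E)%E//.
have : (finite_leb a).-integrable setT (EFin \o (fun x => `|f x| `^ 2)).
  apply: bounded_mfun_integrable; split.
    apply: (measurableT_comp (@measurable_powR R 2)).
    exact: measurableT_comp.
  exists (B `^ 2) => x; rewrite ger0_norm ?powR_ge0//.
  by apply: ge0_ler_powR => //; rewrite nnegrE// (le_trans _ (fB x)).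
by move=> /(integrable_fin_num measurableT); rewrite fin_numElt => /andP[].
Qed.

Theorem proposition1 (R : realType) (a rho : R)
    (a0 : 0 < a) (rho0 : 0 < rho) (rho1 : rho <= 1) :
  exists mu : R, mu < 0 /\ eigenvalue_L2 (@riesz_op R rho a rho0) mu.
Proof.
have [lambda [f [l0 bf f0 fE]]] := riesz_positive_eigenfunction a0 rho0.
exists (Criesz rho * lambda); split.
  by rewrite pmulr_llt0// Criesz_lt0.
exists (Lfun_Sub (lee1n 2) (bounded_mfun_L2 a bf)); split.
  move=> [N [mN N0 fN]].
  have : leb a setT = 0.
    apply/eqP; rewrite eq_le measure_ge0 andbT -N0.
    apply: le_measure; rewrite ?inE// => x _; apply: fN => /= H.
    by have := f0 x; rewrite (H I : f x = 0) ltxx.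
  by rewrite leb_setT// => -[] /eqP; rewrite mulf_eq0 !gt_eqF.
(* the complement of [-a, a], where the equation may fail, is [leb a]-null *)
exists (~` `[- a, a]%classic); split; first exact: measurableC.
  by rewrite /= /mrestr setICl measure0.
move=> x /= /not_implyP[_ nK] Dx; apply: nK.
change (riesz_fun rho a f x = Criesz rho * lambda * f x).
by rewrite /riesz_fun fE// mulrA.
Qed.
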